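(* For every $m\in\mathbb{Z}\setminus\{0\}$, the map $\overline{BS}_m:\mathbb{Z}_m\to\mathcal{G}_2$, $\xi\mapsto\overline{BS}(m,\xi)$, is continuous.
   Context: A marked group on $k$ generators is a pair $(G,S)$ with $S=(s_1,\dots,s_k)\in G^k$ generating $G$, considered up to isomorphisms respecting the markings. $\mathcal{G}_k$ is the set of marked groups on $k$ generators with the ultrametric $d((G_1,S_1),(G_2,S_2))=e^{-\lambda}$, where $\lambda$ is the word length of a shortest element of the free group $\mathbb{F}_k$ that is trivial in one group and not in the other. For $m,n\in\mathbb{Z}\setminus\{0\}$, $BS(m,n)=\langle a,b\mid ab^ma^{-1}=b^n\rangle$, marked by $(a,b)$. The ring of $m$-adic integers is $\mathbb{Z}_m=\varprojlim_h \mathbb{Z}/m^h\mathbb{Z}$ with the projective limit topology (the zero ring if $|m|=1$). For $\xi\in\mathbb{Z}_m$, $\overline{BS}(m,\xi)=\lim_{n\to\infty}BS(m,\xi_n)$ in $\mathcal{G}_2$, where $(\xi_n)_n$ is any sequence of non-zero rational integers with $|\xi_n|\to\infty$ and $\xi_n\to\xi$ in $\mathbb{Z}_m$ (it is known that this limit exists and does not depend on the choice of $(\xi_n)_n$). *)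

(* Defs.v *)
From HB Require Import structures.
From mathcomp Require Import all_boot all_order all_algebra.
From mathcomp Require Import generic_quotient.
From mathcomp Require Import all_classical all_reals all_analysis.

Set Implicit Arguments.
Unset Strict Implicit.
Unset Printing Implicit Defensive.

Import Order.TTheory GRing.Theory Num.Theory.

Local Open Scope classical_set_scope.
Local Open Scope quotient_scope.

(* The indices 0, ..., k-1 of k generators. The type 'I_k would do but for its
   universe, which is too large for a presented group to be a small_group, see
   below. *)
Definition gen_index (k : nat) := {i : nat | (i < k)%N}.

(* A letter (i, true) stands for the i-th generator, (i, false) for its
   inverse. *)
Definition word (k : nat) := seq (gen_index k * bool).

Definition linv (k : nat) (l : gen_index k * bool) : gen_index k * bool :=
  (l.1, ~~ l.2).

Definition winv (k : nat) (w : word k) : word k := rev (map (@linv k) w).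

(* The elements of the free group on k generators are identified with the
   reduced words, so that their word length is [size]. *)
Definition reduced (k : nat) (w : word k) : bool :=
  sorted (fun x y => y != linv x) w.

Section MarkedGroups.
Local Open Scope group_scope.

(* This is groupType with a carrier in a universe of its own: the type of all
   groupTypes is too large to be a choiceType, hence to be topologized. *)
Record small_group := SmallGroup {
  sg_carrier : Type;
  sg_class : Group.axioms_ sg_carrier
}.

Coercion sg_group (G : small_group) : groupType := Group.Pack (sg_class G).

Record marked_group (k : nat) := MarkedGroup {
  mg_group :> small_group;
  mg_gen : gen_index k -> mg_group;
  mg_generates : forall H : set mg_group,
    H 1 -> (forall x y, H x -> H y -> H (x * y)) ->
    (forall x, H x -> H x^-1) -> (forall i, H (mg_gen i)) -> H = setT
}.

HB.instance Definition _ (k : nat) := gen_eqMixin (marked_group k).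
HB.instance Definition _ (k : nat) := gen_choiceMixin (marked_group k).

Definition weval (k : nat) (G : marked_group k) (w : word k) : G :=
  \big[*%g/1]_(l <- w) (if l.2 then mg_gen G l.1 else (mg_gen G l.1)^-1).

Definition marked_iso (k : nat) (G H : marked_group k) : Prop :=
  exists f : G -> H,
    [/\ bijective f, {morph f : x y / x * y} &
        forall i, f (mg_gen G i) = mg_gen H i].

Definition distinguishes (k : nat) (G H : marked_group k) (w : word k) : Prop :=
  ~ (weval G w = 1 <-> weval H w = 1).

(* There is an element of length n in the free group which is trivial in one
   of G, H and not in the other. *)
Definition differ_at (k : nat) (G H : marked_group k) (n : nat) : bool :=
  `[< exists w : word k, [/\ reduced w, size w = n & distinguishes G H w] >].

(* exp(-lambda), with lambda = +oo, i.e. distance 0, if no word distinguishes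
   the two marked groups. *)
Definition marked_dist (R : realType) (k : nat) (G H : marked_group k) : R :=
  match pselect (exists n, differ_at G H n) with
  | left ex => expR (- (ex_minn ex)%:R)%R
  | right _ => 0%R
  end.

Lemma marked_isoxx k (G : marked_group k) : marked_iso G G.
Proof. by exists id; split => //; exists id. Qed.

Lemma marked_iso_sym k (G H : marked_group k) : marked_iso G H -> marked_iso H G.
Proof.
case=> f [[g fK gK] fM fg]; exists g; split; first by exists f.
  by move=> x y; apply: (can_inj fK); rewrite fM !gK.
by move=> i; apply: (can_inj fK); rewrite gK fg.
Qed.

Lemma marked_iso_trans k (G H K : marked_group k) :
  marked_iso G H -> marked_iso H K -> marked_iso G K.
Proof.
case=> f [fb fM fg] [g [gb gM gg]]; exists (g \o f); split.
- exact: bij_comp.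
- by move=> x y /=; rewrite fM gM.
- by move=> i /=; rewrite fg gg.
Qed.

Lemma weval_nil k (G : marked_group k) : weval G [::] = 1.
Proof. by rewrite /weval big_nil. Qed.

Lemma weval_cons k (G : marked_group k) l (w : word k) :
  weval G (l :: w) = weval G [:: l] * weval G w.
Proof. by rewrite /weval !big_cons big_nil mulg1. Qed.

Lemma weval_cat k (G : marked_group k) (u v : word k) :
  weval G (u ++ v) = weval G u * weval G v.
Proof. by rewrite /weval big_cat. Qed.

Lemma weval_linv k (G : marked_group k) (l : gen_index k * bool) :
  weval G [:: linv l] = (weval G [:: l])^-1.
Proof.
by rewrite /weval !big_cons !big_nil !mulg1; case: l => i [] //=; rewrite invgK.
Qed.

Lemma weval_winv k (G : marked_group k) (w : word k) :
  weval G (winv w) = (weval G w)^-1.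
Proof.
elim: w => [|l w IH]; first by rewrite /winv weval_nil invg1.
rewrite /winv map_cons rev_cons -cats1 weval_cat (weval_linv G l) -/(winv w) IH.
by rewrite (weval_cons G l w) invgM.
Qed.

Lemma weval_morph k (G H : marked_group k) (f : G -> H) (w : word k) :
  {morph f : x y / x * y} -> (forall i, f (mg_gen G i) = mg_gen H i) ->
  f (weval G w) = weval H w.
Proof.
move=> fM fg.
have f1 : f 1 = 1 by apply: (@mulgI _ (f 1)); rewrite -fM !mulg1.
have fV x : f x^-1 = (f x)^-1.
  by apply: (@mulgI _ (f x)); rewrite -fM !mulgV f1.
elim: w => [|l w IH]; first by rewrite !weval_nil.
rewrite (weval_cons G) (weval_cons H) fM IH; congr (_ * _).
by rewrite /weval !big_cons !big_nil !mulg1; case: ifP; rewrite ?fV fg.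
Qed.

Lemma weval_surj k (G : marked_group k) (g : G) : exists w, weval G w = g.
Proof.
have := @mg_generates k G [set x | exists w, weval G w = x].
move=> /(_ _ _ _ _)/(congr1 (fun A : set G => A g)) /= -> //.
- by exists [::]; rewrite weval_nil.
- by move=> x y [u <-] [v <-]; exists (u ++ v); rewrite weval_cat.
- by move=> x [u <-]; exists (winv u); rewrite weval_winv.
- by move=> i; exists [:: (i, true)]; rewrite /weval big_cons big_nil mulg1.
Qed.

Lemma reduced_rep k (w : word k) : exists2 w', reduced w' &
  forall G : marked_group k, weval G w' = weval G w.
Proof.
elim: w => [|x w [w' rw' ew']]; first by exists [::].
case: w' rw' ew' => [|y t] rt et.
  by exists [:: x] => // G; rewrite (weval_cons _ _ w) -et weval_nil mulg1.
have [yx|yx] := eqVneq y (linv x); last first.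
  exists (x :: y :: t); first by rewrite /reduced /= yx.
  by move=> G; rewrite (weval_cons _ x (y :: t)) et -weval_cons.
exists t; first by move: rt; rewrite /reduced /=; exact: path_sorted.
move=> G; by rewrite (weval_cons _ x w) -et (weval_cons _ y t) yx weval_linv mulVKg.
Qed.

Lemma marked_iso_weval k (G H : marked_group k) (w : word k) :
  marked_iso G H -> (weval G w = 1 <-> weval H w = 1).
Proof.
case=> f [[g fK gK] fM fg]; rewrite -(weval_morph w fM fg).
have f1 : f 1 = 1 by apply: (@mulgI _ (f 1)); rewrite -fM !mulg1.
split=> [->//|]; rewrite -{1}f1; exact: (can_inj fK).
Qed.

Lemma weval_marked_iso k (G H : marked_group k) :
  (forall w, reduced w -> (weval G w = 1 <-> weval H w = 1)) ->
  marked_iso G H.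
Proof.
move=> GH0.
have GH w : weval G w = 1 <-> weval H w = 1.
  by have [w' rw' ew'] := reduced_rep w; rewrite -!ew'; exact: GH0.
have eqGH u v : weval G u = weval G v <-> weval H u = weval H v.
  have E (K : marked_group k) : weval K u = weval K v <->
      weval K (u ++ winv v) = 1.
    rewrite weval_cat weval_winv; split=> [->|]; first by rewrite mulgV.
    by move=> uv; rewrite -(mulgVK (weval K v) (weval K u)) uv mul1g.
  by rewrite !E.
have [f fP] := choice (@weval_surj k G).
have [g gP] := choice (@weval_surj k H).
exists (fun x => weval H (f x)); split.
- exists (fun y => weval G (g y)) => [x|y] /=.
    by rewrite -[RHS]fP; apply/eqGH; rewrite gP.
  by rewrite -[RHS]gP; apply/eqGH; rewrite fP.
- by move=> x y; rewrite -weval_cat; apply/eqGH; rewrite weval_cat !fP.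
- move=> i; have E (K : marked_group k) : mg_gen K i = weval K [:: (i, true)].
    by rewrite /weval big_cons big_nil mulg1.
  by rewrite (E H); apply/eqGH; rewrite fP E.
Qed.

Lemma distinguishes_sym k (G H : marked_group k) w :
  distinguishes G H w -> distinguishes H G w.
Proof. by rewrite /distinguishes; tauto. Qed.

Lemma marked_dist_ge0 (R : realType) k (G H : marked_group k) :
  (0 <= marked_dist R G H)%R.
Proof. by rewrite /marked_dist; case: pselect => // ?; exact: expR_ge0. Qed.

Lemma marked_dist_ge (R : realType) k (G H : marked_group k) (w : word k) :
  reduced w -> distinguishes G H w ->
  (expR (- (size w)%:R) <= marked_dist R G H)%R.
Proof.
move=> rw dw; have dn : differ_at G H (size w) by apply/asboolP; exists w.
rewrite /marked_dist; case: pselect => [ex|[]]; last by exists (size w).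
by rewrite ler_expR lerN2 ler_nat; case: ex_minnP => n _ /(_ _ dn).
Qed.

Lemma marked_distP (R : realType) k (G H : marked_group k) :
  marked_dist R G H = 0%R \/ exists w, [/\ reduced w, distinguishes G H w &
    marked_dist R G H = expR (- (size w)%:R)%R].
Proof.
rewrite /marked_dist; case: pselect => [ex|_]; [right|by left].
case: ex_minnP => n /asboolP[w [rw sw dw]] _; exists w; split => //.
by rewrite sw.
Qed.

Lemma marked_dist0 (R : realType) k (G H : marked_group k) :
  marked_dist R G H = 0%R <-> marked_iso G H.
Proof.
split=> [d0|GH].
  apply: weval_marked_iso => w rw; apply: contrapT => dw.
  by have := marked_dist_ge R rw dw; rewrite d0 leNgt expR_gt0.
by case: (marked_distP R G H) => // -[w [_ + _]]; case; exact: marked_iso_weval.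
Qed.

Lemma marked_dist_sym (R : realType) k (G H : marked_group k) :
  marked_dist R G H = marked_dist R H G.
Proof.
suff le (A B : marked_group k) : (marked_dist R A B <= marked_dist R B A)%R.
  by apply/eqP; rewrite eq_le !le.
case: (marked_distP R A B) => [->|[w [rw dw ->]]]; first exact: marked_dist_ge0.
by apply: marked_dist_ge => //; exact: distinguishes_sym.
Qed.

Lemma marked_dist_ultra (R : realType) k (H G K : marked_group k) :
  (marked_dist R G K <= Num.max (marked_dist R G H) (marked_dist R H K))%R.
Proof.
rewrite le_max; case: (marked_distP R G K) => [->|[w [rw dw ->]]].
  by rewrite marked_dist_ge0.
have [dGH|dGH] := pselect (distinguishes G H w).
  by rewrite (marked_dist_ge R rw dGH).
have dHK : distinguishes H K w.
  by rewrite /distinguishes => HK; apply: dw; move: dGH => /contrapT ->.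
by rewrite (marked_dist_ge R rw dHK) orbT.
Qed.

Lemma marked_dist_triangle (R : realType) k (H G K : marked_group k) :
  (marked_dist R G K <= marked_dist R G H + marked_dist R H K)%R.
Proof.
apply: (le_trans (marked_dist_ultra R H G K)).
by rewrite ge_max lerDl lerDr !marked_dist_ge0.
Qed.

End MarkedGroups.

Section MarkedIsoQuotient.
Variable k : nat.

Definition marked_isob (G H : marked_group k) : bool := `[< marked_iso G H >].

Lemma marked_isob_equiv : equiv_class_of marked_isob.
Proof.
split.
- by move=> G; apply/asboolP; exact: marked_isoxx.
- by move=> G H; apply/asboolP/asboolP => /marked_iso_sym.
- move=> H G K /asboolP GH /asboolP HK; apply/asboolP.
  exact: marked_iso_trans GH HK.
Qed.

Canonical marked_isob_rel := EquivRelPack marked_isob_equiv.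

(* The parameter R is the field in which distances take their values. *)
Definition marked_space (R : realType) : Type := {eq_quot marked_isob}.

Variable R : realType.
HB.instance Definition _ := Choice.on (marked_space R).

Definition mclass (G : marked_group k) : marked_space R :=
  (\pi_({eq_quot marked_isob}) G)%qT.

Definition space_dist (x y : marked_space R) : R :=
  marked_dist R (repr (x : {eq_quot marked_isob}))
                (repr (y : {eq_quot marked_isob})).

Lemma mclass_eq (G H : marked_group k) : mclass G = mclass H <-> marked_iso G H.
Proof. by split=> [/eqmodP/asboolP|GH]; last exact/eqmodP/asboolP. Qed.

Lemma mclass_repr (x : marked_space R) :
  mclass (repr (x : {eq_quot marked_isob})) = x.
Proof. exact: (@reprK _ {eq_quot marked_isob}). Qed.

Lemma space_distE (G H : marked_group k) :
  space_dist (mclass G) (mclass H) = marked_dist R G H.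
Proof.
have E (A B C : marked_group k) : marked_iso A B ->
    marked_dist R A C = marked_dist R B C.
  move=> AB; apply/eqP; rewrite eq_le; apply/andP; split.
    have := marked_dist_triangle R B A C.
    by rewrite ((marked_dist0 R A B).2 AB) add0r.
  have := marked_dist_triangle R A B C.
  by rewrite ((marked_dist0 R B A).2 (marked_iso_sym AB)) add0r.
have I (A : marked_group k) :
    marked_iso (repr (mclass A : {eq_quot marked_isob})) A.
  by apply/mclass_eq; exact: mclass_repr.
by rewrite /space_dist (E _ _ _ (I G)) marked_dist_sym (E _ _ _ (I H))
  marked_dist_sym.
Qed.

Lemma space_dist_xx x : space_dist x x = 0%R.
Proof. by apply/marked_dist0; exact: marked_isoxx. Qed.

Lemma space_dist_pos x y : space_dist x y = 0%R -> x = y.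
Proof.
by move=> /marked_dist0 xy; rewrite -(mclass_repr x) -(mclass_repr y);
  apply/mclass_eq.
Qed.

Lemma space_dist_sym x y : space_dist x y = space_dist y x.
Proof. exact: marked_dist_sym. Qed.

Lemma space_dist_triangle y x z :
  (space_dist x z <= space_dist x y + space_dist y z)%R.
Proof. exact: marked_dist_triangle. Qed.

HB.instance Definition _ := @isMetric.Build R (marked_space R)
  space_dist space_dist_xx space_dist_pos space_dist_sym space_dist_triangle.

End MarkedIsoQuotient.

Section Presentations.
Variables (k : nat) (r : word k -> word k -> Prop).

(* The congruence on words whose quotient is the group with generators
   s_1, ..., s_k and relations u = v for r u v. *)
Inductive pres_eq : word k -> word k -> Prop :=
| PresRel u v : r u v -> pres_eq u v
| PresCancel l : pres_eq [:: l; linv l] [::]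
| PresRefl u : pres_eq u u
| PresSym u v : pres_eq u v -> pres_eq v u
| PresTrans u v w : pres_eq u v -> pres_eq v w -> pres_eq u w
| PresCat u u' v v' : pres_eq u u' -> pres_eq v v' ->
    pres_eq (u ++ v) (u' ++ v').

(* The set of congruence classes; unlike {eq_quot _}, it fits as the carrier of a
   small_group. *)
Definition presented := {A : word k -> Prop | exists u, A = pres_eq u}.

HB.instance Definition _ := gen_eqMixin presented.
HB.instance Definition _ := gen_choiceMixin presented.

Definition pclass (u : word k) : presented :=
  exist _ (pres_eq u) (ex_intro _ u erefl).

Definition prepr (x : presented) : word k := sval (cid (svalP x)).

Lemma pclass_eq u v : pclass u = pclass v <-> pres_eq u v.
Proof.
split=> [/(congr1 sval) /= ->|uv]; first exact: PresRefl.
apply: eq_exist => /=; apply/funext => w; apply/propext.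
by split=> h; [exact: PresTrans (PresSym uv) h|exact: PresTrans uv h].
Qed.

Lemma preprK x : pclass (prepr x) = x.
Proof.
by case: x => A p; apply: eq_exist; rewrite /prepr; case: cid => u /= ->.
Qed.

Lemma pclassK u : pres_eq (prepr (pclass u)) u.
Proof. by apply/pclass_eq; exact: preprK. Qed.

Lemma linvK : involutive (@linv k).
Proof. by case=> i b; rewrite /linv /= negbK. Qed.

Lemma winvK : involutive (@winv k).
Proof.
by move=> u; rewrite /winv map_rev revK -map_comp -[RHS]map_id;
  apply: eq_map => l /=; rewrite linvK.
Qed.

Lemma winv_cat (u v : word k) : winv (u ++ v) = winv v ++ winv u.
Proof. by rewrite /winv map_cat rev_cat. Qed.

Lemma pres_eq_mulV u : pres_eq (u ++ winv u) [::].
Proof.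
elim: u => [|l u IH]; first exact: PresRefl.
have -> : (l :: u) ++ winv (l :: u) = [:: l] ++ (u ++ winv u) ++ [:: linv l].
  by rewrite /winv map_cons rev_cons -cats1 /= -!catA.
apply: (@PresTrans _ ([:: l] ++ [::] ++ [:: linv l])); last exact: PresCancel.
apply: PresCat; first exact: PresRefl.
by apply: PresCat => //; exact: PresRefl.
Qed.

Lemma pres_eq_Vmul u : pres_eq (winv u ++ u) [::].
Proof. by have := pres_eq_mulV (winv u); rewrite winvK. Qed.

Lemma pres_eq_inv u v : pres_eq u v -> pres_eq (winv u) (winv v).
Proof.
move=> uv; apply: (@PresTrans _ (winv u ++ v ++ winv v)).
  rewrite -{1}[winv u]cats0; apply: PresCat; first exact: PresRefl.
  by apply: PresSym; exact: pres_eq_mulV.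
apply: (@PresTrans _ ((winv u ++ u) ++ winv v)).
  rewrite -catA; apply: PresCat; first exact: PresRefl.
  by apply: PresCat; [exact: PresSym|exact: PresRefl].
rewrite -[X in pres_eq _ X]cat0s.
by apply: PresCat; [exact: pres_eq_Vmul|exact: PresRefl].
Qed.

Definition pmul (x y : presented) : presented := pclass (prepr x ++ prepr y).
Definition pone : presented := pclass [::].
Definition pinv (x : presented) : presented := pclass (winv (prepr x)).

Lemma pmulE u v : pmul (pclass u) (pclass v) = pclass (u ++ v).
Proof. by apply/pclass_eq; apply: PresCat; exact: pclassK. Qed.

Lemma pinvE u : pinv (pclass u) = pclass (winv u).
Proof. by apply/pclass_eq; apply: pres_eq_inv; exact: pclassK. Qed.

Lemma pmulA : associative pmul.
Proof.
by move=> x y z; rewrite -(preprK x) -(preprK y) -(preprK z) !pmulE catA.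
Qed.

Lemma pmul1 : left_id pone pmul.
Proof. by move=> x; rewrite -(preprK x) /pone pmulE. Qed.

Lemma pmulr1 : right_id pone pmul.
Proof. by move=> x; rewrite -(preprK x) /pone pmulE cats0. Qed.

Lemma pmulV : left_inverse pone pinv pmul.
Proof.
move=> x; rewrite -(preprK x) pinvE pmulE; apply/pclass_eq.
exact: pres_eq_Vmul.
Qed.

Lemma pmulrV : right_inverse pone pinv pmul.
Proof.
move=> x; rewrite -(preprK x) pinvE pmulE; apply/pclass_eq.
exact: pres_eq_mulV.
Qed.

HB.instance Definition _ := isGroup.Build presented
  pmulA pmul1 pmulr1 pmulV pmulrV.

Definition pgen (i : gen_index k) : presented := pclass [:: (i, true)].

Lemma pgen_generates (H : set presented) : H 1%g ->
  (forall x y, H x -> H y -> H (x * y)%g) -> (forall x, H x -> H x^-1%g) ->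
  (forall i, H (pgen i)) -> H = setT.
Proof.
move=> H1 HM HV Hg; apply/seteqP; split => // x _; rewrite -(preprK x).
elim: (prepr x) => [|[i b] w IH]; first exact: H1.
rewrite -cat1s -pmulE; apply: HM IH; case: b; first exact: Hg.
by rewrite (_ : pclass _ = (pgen i)^-1%g); [exact/HV/Hg|exact/esym/pinvE].
Qed.

Definition presented_group : marked_group k :=
  @MarkedGroup k (@SmallGroup presented (Group.class presented)) pgen pgen_generates.

End Presentations.

Section BaumslagSolitar.

Definition letter_a : gen_index 2 := exist _ 0%N isT.
Definition letter_b : gen_index 2 := exist _ 1%N isT.

Definition wpow (k : nat) (i : gen_index k) (z : int) : word k :=
  nseq `|z|%N (i, (0 <= z)%R).

Definition bs_rel (m n : int) (u v : word 2) : Prop :=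
  u = wpow letter_a 1 ++ wpow letter_b m ++ wpow letter_a (-1) /\
  v = wpow letter_b n.

Definition BS (R : realType) (m n : int) : marked_space 2 R :=
  mclass R (presented_group (bs_rel m n)).

End BaumslagSolitar.

Section Adic.
Variable m : int.

(* Z / m^h Z, for m <> 0; recall that 'I_n.+1 is Z / (n+1) Z. *)
Definition residues (h : nat) : Type := 'I_(`|m| ^ h).-1.+1.
HB.instance Definition _ (h : nat) := Choice.on (residues h).

Definition residue (h : nat) (z : int) : residues h :=
  inZp `|(z %% m ^+ h)%Z|%N.

(* The projective limit, as a set of compatible families; coerced to a type, it
   carries the topology induced by the product of the discrete topologies. *)
Definition Zadic :
    set (prod_topology (fun h : nat => discrete_topology (residues h))) :=
  [set x | forall h, residue h (x h.+1 : residues h.+1)%:Z%R = x h].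

Lemma residueE (h : nat) (z : int) : m != 0%R ->
  ((residue h z)%:Z = (z %% m ^+ h)%Z)%R.
Proof.
move=> m0; have mh0 : (m ^+ h)%R != 0%R by rewrite expf_neq0.
rewrite /residue /= prednK ?expn_gt0 ?absz_gt0 ?m0 // modn_small.
  by rewrite gez0_abs // modz_ge0.
rewrite -ltz_nat gez0_abs ?modz_ge0 // -abszX.
by rewrite (lt_le_trans (ltz_mod _ mh0)).
Qed.

Lemma residue_compat (z : int) (h : nat) :
  residue h (residue h.+1 z)%:Z%R = residue h z.
Proof.
have [m0|m0] := eqVneq m 0%R.
  have h1 : (`|m| ^ h).-1.+1 = 1%N by rewrite m0; case: h => // h; rewrite exp0n.
  by apply/val_inj; rewrite /= h1 !modn1.
apply/val_inj/eqP; rewrite -eqz_nat; apply/eqP.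
by rewrite !residueE // [in RHS](divz_eq z (m ^+ h.+1)%R) exprS mulrA modzMDl.
Qed.

Definition Zadic_of_int (z : int) : Zadic :=
  exist _ (fun h => residue h z) (mem_set (residue_compat z)).

End Adic.

Arguments Zadic : clear implicits.

Definition admissible (m : int) (xi : Zadic m) (u : nat -> int) : Prop :=
  [/\ forall n, u n != 0%R,
      `|u n|%N @[n --> \oo] --> \oo &
      Zadic_of_int m (u n) @[n --> \oo] --> xi].

Definition is_BSbar (R : realType) (m : int) (xi : Zadic m)
    (L : marked_space 2 R) : Prop :=
  forall u, admissible xi u -> BS R m (u n) @[n --> \oo] --> L.

(* The limit of BS(m, u_n) common to all admissible sequences u for xi. It
   exists for m <> 0, so that the default value BS R m 1 is irrelevant. *)
Definition BSbar (R : realType) (m : int) (xi : Zadic m) : marked_space 2 R :=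
  xget (BS R m 1) [set L | is_BSbar xi L].

(* Main.v *)
(* A word w is rewritten as b^k0 a^e1 b^k1 ... a^el b^kl with exponents depending
   on n. By Britton's lemma, it is trivial in BS(m, n) only if it is empty or
   contains a pinch a b^(m q) a^-1 = b^(n q) or a^-1 b^(n q) a = b^(m q), and
   removing a pinch keeps the exponents of the form p(n) / m^j with p an integer
   polynomial. Whether m divides p(n) / m^j depends on n modulo m^(j+1) only;
   n divides p(n) / m^j, for |n| > |p(0)|, iff p(0) = 0 and m^j divides p(n) / n.
   Hence, as |n| tends to infinity and n tends to xi in Z_m, the same pinches
   occur for all n, and "w = 1 in BS(m, n)" is eventually constant. So BS(m, n)
   converges to the group whose relations are those that eventually hold.
   For the finitely many words of bounded length, this involves xi only modulo
   some m^h, whence the continuity. *)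

Require Import Defs.
From HB Require Import structures.
From mathcomp Require Import all_boot all_order all_algebra.
From mathcomp Require Import all_classical all_reals all_analysis.
From mathcomp Require Import zify.

Set Implicit Arguments.
Unset Strict Implicit.
Unset Printing Implicit Defensive.

Import Order.TTheory GRing.Theory Num.Theory.

Local Open Scope ring_scope.
Local Open Scope classical_set_scope.

(** * Integer powers in a group *)

Section IntegerPowers.
Local Open Scope group_scope.
Variable G : groupType.

Definition zpow (y : G) (z : int) : G :=
  match z with Posz n => y ^+ n | Negz n => y ^- n.+1 end.

Lemma zpowS y z : zpow y (z + 1)%R = zpow y z * y.
Proof.
case: z => [p|[|p]].
- by rewrite (_ : Posz p + 1 = Posz p.+1)%R; [exact: expgSr|lia].
- by rewrite /= expg1 mulVg.
- rewrite (_ : Negz p.+1 + 1 = Negz p)%R; last by lia.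
  by rewrite /= [in RHS]expgS invgM mulgVK.
Qed.

Lemma zpowD y z t : zpow y (z + t)%R = zpow y z * zpow y t.
Proof.
elim/int_rect: t => [|p IH|p IH]; first by rewrite addr0 mulg1.
- by rewrite intS [(1 + _)%R]addrC addrA !zpowS IH mulgA.
- apply: (@mulIg _ y); rewrite -zpowS -mulgA -zpowS -addrA.
  by rewrite (_ : - p.+1%:Z + 1 = - p%:Z)%R ?IH //; lia.
Qed.

Lemma zpowM y z t : zpow y (z * t)%R = zpow (zpow y z) t.
Proof.
elim/int_rect: t => [|p IH|p IH]; first by rewrite mulr0.
- by rewrite intS [(1 + _)%R]addrC mulrDr mulr1 zpowD zpowS IH.
- apply: (@mulIg _ (zpow y z)); rewrite -zpowD -zpowS.
  rewrite (_ : - p.+1%:Z + 1 = - p%:Z)%R; last by lia.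
  by rewrite -IH; congr (zpow _ _); nia.
Qed.

Lemma zpowJ x y z : x * zpow y z * x^-1 = zpow (x * y * x^-1) z.
Proof.
have J w : x * w * x^-1 = w ^ x^-1 by rewrite conjgE invgK mulgA.
by case: z => n; rewrite !J /= ?conjVg conjXg.
Qed.

End IntegerPowers.

(** * Words in the two generators and Britton reductions *)

Section BaumslagSolitarWords.
Variables m n : int.

Notation G := (presented_group (bs_rel m n)).

Lemma weval_presented k (r : word k -> word k -> Prop) (w : word k) :
  weval (presented_group r) w = pclass r w.
Proof.
elim: w => [|l w IH]; first by rewrite weval_nil.
rewrite weval_cons IH -[in RHS]cat1s -pmulE; congr (_ * _)%g.
rewrite /weval big_cons big_nil mulg1; case: l => i [] //=.
by rewrite -[LHS]/(Defs.pinv (pclass r [:: (i, true)])) pinvE.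
Qed.

Lemma weval_presented1 k (r : word k -> word k -> Prop) (w : word k) :
  weval (presented_group r) w = 1%g <-> pres_eq r w [::].
Proof. by rewrite weval_presented; exact: pclass_eq. Qed.

Lemma weval_wpow k (H : marked_group k) i z :
  weval H (wpow i z) = zpow (mg_gen H i) z.
Proof.
have E b p : weval H (nseq p (i, b)) =
    ((if b then mg_gen H i else (mg_gen H i)^-1) ^+ p)%g.
  elim: p => [|p IH]; first by rewrite weval_nil.
  by rewrite /= weval_cons IH expgS /weval big_cons big_nil mulg1.
by rewrite /wpow E; case: z => p //=; rewrite expVgn.
Qed.

(* The relation of BS(m, n) is a^e b^(bs_exp e) a^-e = b^(bs_exp (~~ e)) for
   either sign e. *)
Definition bs_exp (e : bool) : int := if e then m else n.

(* The word b^k a^e1 b^k1 ... a^el b^kl, for s = [:: (e1, k1); ...; (el, kl)]. *)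
Fixpoint sword (k : int) (s : seq (bool * int)) : word 2 :=
  wpow letter_b k ++
  (if s is (e, k1) :: s' then (letter_a, e) :: sword k1 s' else [::]).

(** One Britton reduction. The quotient [q] is a parameter, not computed by division, so that a
    function of [n] can be supplied for it. *)
Inductive pinch : int -> seq (bool * int) -> int -> seq (bool * int) -> Prop :=
| PinchHead k e q k2 s :
    pinch k ((e, bs_exp e * q) :: (~~ e, k2) :: s) (k + bs_exp (~~ e) * q + k2) s
| PinchTail k e k1 s k1' s' :
    pinch k1 s k1' s' -> pinch k ((e, k1) :: s) k ((e, k1') :: s').

Fixpoint unpinched (s : seq (bool * int)) : bool :=
  if s is (e, k1) :: s' then
    (if s' is (e2, _) :: _ then ~~ ((e2 == ~~ e) && (bs_exp e %| k1)%Z) else true)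
    && unpinched s'
  else true.

Lemma bs_relation e q :
  (weval G [:: (letter_a, e)] * zpow (mg_gen G letter_b) (bs_exp e * q)%R
     * weval G [:: (letter_a, ~~ e)] =
   zpow (mg_gen G letter_b) (bs_exp (~~ e) * q)%R)%g.
Proof.
set x := mg_gen G letter_a; set y := mg_gen G letter_b.
have R : (x * zpow y m * x^-1)%g = zpow y n.
  transitivity (weval G (wpow letter_a 1 ++ wpow letter_b m ++ wpow letter_a (-1))).
    by rewrite !weval_cat !weval_wpow -mulgA.
  rewrite -weval_wpow !weval_presented; apply/pclass_eq; exact: PresRel.
have E b : weval G [:: (letter_a, b)] = (if b then x else x^-1)%g.
  by rewrite /weval big_cons big_nil mulg1; case: b.
rewrite !E; case: e => /=; rewrite !zpowM.
  by rewrite zpowJ R.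
by rewrite -R -zpowJ !mulgA mulVg mul1g mulgVK.
Qed.

Lemma weval_swordD k k' s :
  weval G (sword (k + k') s) = (zpow (mg_gen G letter_b) k * weval G (sword k' s))%g.
Proof.
by case: s => [|[e k1] s]; rewrite !weval_cat !weval_wpow zpowD mulgA.
Qed.

Lemma weval_sword_cons k e k1 s :
  weval G (sword k ((e, k1) :: s)) =
  (zpow (mg_gen G letter_b) k * (weval G [:: (letter_a, e)] * weval G (sword k1 s)))%g.
Proof. by rewrite weval_cat weval_wpow [in LHS]weval_cons. Qed.

Lemma pinch_weval k s k' s' : pinch k s k' s' ->
  weval G (sword k s) = weval G (sword k' s').
Proof.
elim=> {k s k' s'} [k e q k2 s|k e k1 s k1' s' _ IH].
  by rewrite weval_sword_cons -[(_ * q)%R]addr0 !weval_swordD weval_sword_cons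
    zpowD -bs_relation !mulgA /= mulg1.
by rewrite !weval_sword_cons IH.
Qed.

(** * Britton's lemma, from an action on normal forms *)

Section NormalForms.
Hypotheses (m0 : m != 0) (n0 : n != 0).

Let exp0 e : bs_exp e != 0.
Proof. by case: e. Qed.

(* A pair (k, s) with s normal is the normal form of the element sword k s: each
   element has exactly one. Left multiplication by the generators becomes an
   action of BS(m, n) on these pairs, where [aact e] is that of a^e. *)
Fixpoint normal (s : seq (bool * int)) : bool :=
  if s is (e, r) :: s' then
    [&& 0 <= r, r < `|bs_exp e|,
        (if s' is (e', _) :: _ then ~~ ((r == 0) && (e' == ~~ e)) else true)
      & normal s']
  else true.

Definition aact (e : bool) (x : int * seq (bool * int)) : int * seq (bool * int) :=
  let q := (x.1 %/ bs_exp e)%Z in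
  let r := (x.1 %% bs_exp e)%Z in
  let push := (bs_exp (~~ e) * q, (e, r) :: x.2) in
  if x.2 is (e', r') :: s' then
    if (r == 0) && (e' == ~~ e) then (bs_exp (~~ e) * q + r', s') else push
  else push.

Lemma aact_normal e x : normal x.2 -> normal (aact e x).2.
Proof.
have B k : (0 <= (k %% bs_exp e)%Z) && ((k %% bs_exp e)%Z < `|bs_exp e|).
  by rewrite modz_ge0 ?ltz_mod.
case: x => k [|[e' r'] s'] /= H; first by rewrite andbT B.
rewrite /aact /=; case: ifP => C /=; first by case/and4P: H.
by rewrite C H !andbT B.
Qed.

(** After a push, the exponent is a multiple of [bs_exp (~~ e)], so the inverse letter cancels the
    pushed one. After a cancellation, division recovers the remainder [r'], and normality makes the
    inverse letter push. *)
Lemma aactK e x : normal x.2 -> aact (~~ e) (aact e x) = x.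
Proof.
case: x => k s /= H; rewrite {2}/aact /=.
have E : k = (k %/ bs_exp e)%Z * bs_exp e + (k %% bs_exp e)%Z by exact: divz_eq.
have push : aact (~~ e) (bs_exp (~~ e) * (k %/ bs_exp e)%Z,
    (e, (k %% bs_exp e)%Z) :: s) = (k, s).
  by rewrite /aact /= mulKz ?exp0 // modzMr negbK !eqxx /= mulrC -E.
case: s H push => [|[e' r'] s'] H push /=; first exact: push.
case: ifP => C; last exact: push.
case/andP: C => /eqP r0 /eqP ->{e' push} in H *.
rewrite /aact /= negbK.
case/and4P: H => r'0 r'M Hs' _.
have D : ((bs_exp (~~ e) * (k %/ bs_exp e)%Z + r') %/ bs_exp (~~ e))%Z =
    (k %/ bs_exp e)%Z.
  by rewrite mulrC divzMDl ?exp0 // (@divz_small r') ?addr0 // r'0.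
have M : ((bs_exp (~~ e) * (k %/ bs_exp e)%Z + r') %% bs_exp (~~ e))%Z = r'.
  by rewrite mulrC modzMDl -modz_abs modz_small // r'0.
rewrite D M.
have K : bs_exp e * (k %/ bs_exp e)%Z = k by rewrite mulrC [RHS]E r0 addr0.
case: s' Hs' => [|[e2 r2] s2]; first by rewrite K.
by rewrite negbK K => /negbTE ->.
Qed.

Definition lact (l : gen_index 2 * bool) (x : int * seq (bool * int)) :=
  if sval l.1 == 0%N then aact l.2 x else (x.1 + (if l.2 then 1 else -1), x.2).

Definition wact (w : word 2) (x : int * seq (bool * int)) := foldr lact x w.

Lemma wact_cat u v x : wact (u ++ v) x = wact u (wact v x).
Proof. exact: foldr_cat. Qed.

Lemma wact_normal w x : normal x.2 -> normal (wact w x).2.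
Proof.
move=> H; elim: w => //= -[i e] w IH; rewrite /lact /=.
by case: ifP => // _; exact: aact_normal.
Qed.

Lemma wact_wpow_b k x : wact (wpow letter_b k) x = (k + x.1, x.2).
Proof.
have E b p : wact (nseq p (letter_b, b)) x = ((if b then p%:Z else - p%:Z) + x.1, x.2).
  elim: p => [|p IH] /=; first by case: x b => ? ? [] /=; rewrite ?oppr0 add0r.
  by rewrite IH /lact /= {IH}; congr (_, _); case: b; lia.
by rewrite /wpow E; congr (_, _); case: k => p //=; lia.
Qed.

Lemma wact_pres_eq u v x : pres_eq (bs_rel m n) u v -> normal x.2 ->
  wact u x = wact v x.
Proof.
move=> uv; elim: uv x => {u v} [u v [-> ->]|l|//|u v _ IH
  |u v w _ IH1 _ IH2|u u' v v' _ IH1 _ IH2] x nx.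
- rewrite !wact_cat !wact_wpow_b.
  have -> : wact (wpow letter_a (-1)) x = aact false x by [].
  rewrite -[LHS]/(aact true _).
  have := aactK false nx; have := aact_normal false nx.
  rewrite /=; case: (aact false x) => k s /=.
  (* Adding [m] to the exponent raises the quotient by one and keeps the remainder, so the result
     shifts by [n]. *)
  rewrite /aact /= divzDl // divzz m0 modzDl.
  move: x nx => [k' s'] nx ns <-.
  case: s ns => [|[e r] s] _ /=; first by rewrite mulrDr mulr1.
  by case: ifP => _ /=; rewrite mulrDr mulr1 // addrA.
- case: l => i b; rewrite /= /linv /lact /=; case: eqP => _ /=.
    by rewrite -{1}[b]negbK aactK.
  by case: x nx => k s _; case: b => /=; congr (_, _); lia.
- by rewrite IH.
- by rewrite IH1 ?IH2.
- by rewrite !wact_cat IH2 // IH1 //; exact: wact_normal.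
Qed.

(** No [a]-letter cancels: the exponent is tracked modulo [bs_exp (~~ e)], which is enough to tell
    whether the letter to its left could cancel. Congruence modulo 0 is equality. *)
Lemma unpinched_wact k s : unpinched s ->
  [seq p.1 | p <- (wact (sword k s) (0, [::])).2] = [seq p.1 | p <- s] /\
  (wact (sword k s) (0, [::])).1 =
    k %[mod (if s is (e, _) :: _ then bs_exp (~~ e) else 0)]%Z.
Proof.
elim: s k => [|[e k1] s IH] k /=.
  by rewrite cats0 wact_wpow_b addr0.
case/andP => H /(IH k1)[]; rewrite wact_cat wact_wpow_b /= /lact /=.
case: (wact _ _) => k2 s2 /= E1 E2; rewrite /aact /=.
case: s2 E1 => [|[e2 r2] s2] E1 /=.
  by rewrite -E1 /= addrC mulrC modzMDl.
case: s IH H E1 E2 => [//|[e3 k3] s] _ H [-> ss] E2 /=.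
(* A cancellation would make [k1] divisible by [bs_exp e], hence give a pinch. *)
case: ifP => [/andP[r0 /eqP e3E]|_] /=; last by rewrite ss addrC mulrC modzMDl.
by move: H r0 E2; rewrite e3E eqxx negbK /= => /dvdz_mod0P H /eqP -> /esym.
Qed.


Lemma britton k s : unpinched s -> pres_eq (bs_rel m n) (sword k s) [::] ->
  k = 0 /\ s = [::].
Proof.
move=> us e1; have E := @wact_pres_eq _ _ (0, [::]) e1 isT.
have [] := unpinched_wact k us; rewrite E /=.
by case: s {us E e1} => //= _; rewrite !modz0 => <-.
Qed.

End NormalForms.

End BaumslagSolitarWords.

(** * Values of integer polynomials *)

(** A root divides the constant coefficient, which bounds it if that coefficient is nonzero;
    otherwise a factor ['X] splits off. *)
Lemma poly_int_large_neq0 (p : {poly int}) : p != 0 ->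
  exists N : nat, forall z : int, (N < `|z|)%N -> p.[z] != 0.
Proof.
elim/poly_ind: p => [|p c IH] p0; first by rewrite eqxx in p0.
have [c0|c0] := eqVneq c 0; last first.
  exists `|c|%N => z cz; rewrite hornerMXaddC; apply/eqP => pz.
  have : (z %| c)%Z by apply/dvdzP; exists (- p.[z]); lia.
  by rewrite dvdzE => /dvdn_leq; rewrite absz_gt0 c0 leqNgt cz => /(_ isT).
have [|N HN] := IH.
  by apply: contraNneq p0 => ->; rewrite c0 mul0r add0r.
exists N => z Nz; rewrite hornerMXaddC c0 addr0 mulf_neq0 ?HN //.
by rewrite -absz_gt0 (leq_ltn_trans _ Nz).
Qed.

Lemma poly_int_congr (p : {poly int}) (d x y : int) :
  (x = y %[mod d])%Z -> (p.[x] = p.[y] %[mod d])%Z.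
Proof.
move=> xy; elim/poly_ind: p => [|p c IH]; first by rewrite !horner0.
by rewrite !hornerMXaddC -modzDml -modzMm IH xy modzMm modzDml.
Qed.

(** * Triviality of a word is eventually constant along a filter *)

Section EventualTriviality.
Variables (m : int) (F : set_system int).
Hypotheses (m0 : m != 0) (FF : Filter F).
Hypothesis F_large : forall N, \forall n \near F, (N < `|n|)%N.
Hypothesis F_congr : forall h, exists c, \forall n \near F, (n = c %[mod m ^+ h])%Z.

Definition decided (P : int -> Prop) :=
  (\forall n \near F, P n) \/ (\forall n \near F, ~ P n).

(* Eventually f n = p(n) / m^j. *)
Definition quasipoly (f : int -> int) := exists (p : {poly int}) (j : nat),
  \forall n \near F, m ^+ j * f n = p.[n].

Lemma quasipoly_cst c : quasipoly (fun=> c).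
Proof. by exists c%:P, 0%N; apply: filterE => n; rewrite expr0 mul1r hornerC. Qed.

Lemma quasipolyD f g : quasipoly f -> quasipoly g -> quasipoly (fun n => f n + g n).
Proof.
move=> [p [j Hp]] [q [i Hq]]; exists ((m ^+ i)%:P * p + (m ^+ j)%:P * q), (j + i)%N.
apply: filterS2 Hp Hq => n Hp Hq; rewrite hornerD !hornerM !hornerC -Hp -Hq.
by rewrite exprD mulrDr -mulrA [in LHS]mulrCA -mulrA.
Qed.

Lemma quasipolyM f g : quasipoly f -> quasipoly g -> quasipoly (fun n => f n * g n).
Proof.
move=> [p [j Hp]] [q [i Hq]]; exists (p * q), (j + i)%N.
by apply: filterS2 Hp Hq => n Hp Hq; rewrite hornerM -Hp -Hq exprD mulrACA.
Qed.

Lemma quasipoly_bs_exp e : quasipoly (fun n => bs_exp m n e).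
Proof.
case: e; first exact: quasipoly_cst.
by exists 'X, 0%N; apply: filterE => n; rewrite expr0 mul1r hornerX.
Qed.

Let mX0 j : m ^+ j != 0.
Proof. by rewrite expf_neq0. Qed.

Lemma near_neq0 : \forall n \near F, n != 0.
Proof. by apply: filterS (F_large 0) => n; rewrite absz_gt0. Qed.

Lemma quasipoly_eq0_decided f : quasipoly f -> decided (fun n => f n = 0).
Proof.
move=> [p [j Hp]]; have [p0|/poly_int_large_neq0[N HN]] := eqVneq p 0; [left|right].
  apply: filterS Hp => n /eqP.
  by rewrite p0 horner0 mulf_eq0 (negbTE (mX0 j)) => /eqP.
by apply: filterS2 Hp (F_large N) => n Hp /HN/eqP pn fn;
  apply: pn; rewrite -Hp fn mulr0.
Qed.

Lemma dvdz_poly_decided (p : {poly int}) j :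
  decided (fun n => (m ^+ j %| p.[n])%Z).
Proof.
have [c Fc] := F_congr j.
have E n : (n = c %[mod m ^+ j])%Z -> (m ^+ j %| p.[n])%Z = (m ^+ j %| p.[c])%Z.
  by move=> /(poly_int_congr p) nc; apply/dvdz_mod0P/dvdz_mod0P; rewrite nc.
have [pc|/negP pc] := boolP (m ^+ j %| p.[c])%Z; [left|right];
  by apply: filterS Fc => n /E ->.
Qed.

(** The quotient is again a quasi-polynomial, so reductions can be iterated: dividing by [m] raises
    the power of [m] in the denominator, dividing by [n] removes a factor ['X] from the
    numerator. *)
Lemma quasipoly_dvd f e : quasipoly f ->
  (exists2 g, quasipoly g & \forall n \near F, f n = bs_exp m n e * g n) \/
  \forall n \near F, ~~ (bs_exp m n e %| f n)%Z.
Proof.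
move=> [p [j Hp]]; case: e => /=.
  have D n : m ^+ j * f n = p.[n] -> (m ^+ j.+1 %| p.[n])%Z = (m %| f n)%Z.
    by move=> <-; rewrite exprSr dvdz_mul2l.
  have [mp|mp] := dvdz_poly_decided p j.+1; [left|right].
    exists (fun n => (f n %/ m)%Z); last first.
      by apply: filterS2 Hp mp => n /D -> mf; rewrite mulrC divzK.
    exists p, j.+1; apply: filterS2 Hp mp => n Hp; rewrite D // => mf.
    by rewrite -Hp exprSr -mulrA [m * _]mulrC divzK.
  by apply: filterS2 Hp mp => n /D -> /negP.
(* The induction only splits off the constant coefficient [c]; if [n] divides [f n], it divides
   [c]. *)
elim/poly_ind: p Hp => [|q c _] Hp.
  left; exists (fun=> 0); first exact: quasipoly_cst.
  apply: filterS Hp => n /eqP.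
  by rewrite mulr0 horner0 mulf_eq0 (negbTE (mX0 j)) => /eqP.
have [c0|c0] := eqVneq c 0; last first.
  right; apply: filterS2 Hp (F_large `|c|%N) => n Hp cn; apply/negP => nf.
  have : (n %| c)%Z.
    have -> : c = m ^+ j * f n - q.[n] * n.
      by rewrite Hp hornerMXaddC addrAC subrr add0r.
    by rewrite rpredB // dvdz_mull.
  by rewrite dvdzE => /dvdn_leq; rewrite absz_gt0 c0 leqNgt cn => /(_ isT).
have Hq : \forall n \near F, m ^+ j * f n = q.[n] * n.
  by apply: filterS Hp => n ->; rewrite hornerMXaddC c0 addr0.
have [mq|mq] := dvdz_poly_decided q j; [left|right].
  exists (fun n => (q.[n] %/ m ^+ j)%Z).
    by exists q, j; apply: filterS mq => n mq; rewrite mulrC divzK.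
  apply: filterS2 Hq mq => n Hq mq; apply: (mulfI (mX0 j)).
  by rewrite Hq mulrCA [m ^+ j * _]mulrC divzK // mulrC.
apply: filterS3 near_neq0 Hq mq => n n0 Hq mq; apply/negP => /dvdzP[t ft]; apply: mq.
by apply/dvdzP; exists t; apply: (mulIf n0); rewrite -Hq ft mulrCA mulrA.
Qed.

Implicit Types s : seq (bool * (int -> int)).

Fixpoint quasipolys s : Prop :=
  if s is (_, f) :: s' then quasipoly f /\ quasipolys s' else True.

Definition seval s (n : int) := [seq (p.1, p.2 n) | p <- s].

(** The pinch sits at a position independent of [n]. Once the tail is unpinched, only the two
    leading [a]-letters remain to be tested. *)
Lemma pinch_or_unpinched k s : quasipoly k -> quasipolys s ->
  (exists k' s', [/\ quasipoly k', quasipolys s', (size s' < size s)%N &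
    \forall n \near F, pinch m n (k n) (seval s n) (k' n) (seval s' n)]) \/
  \forall n \near F, unpinched m n (seval s n).
Proof.
elim: s k => [|[e k1] s IH] k qk; first by right; apply: filterE.
case=> qk1 qs.
have [[k' [s' [qk' qs' ss' P]]]|U] := IH _ qk1 qs.
  left; exists k, ((e, k') :: s'); split => //.
  by apply: filterS P => n; exact: PinchTail.
case: s IH qs U => [|[e2 k2] s] IH qs U; first by right; apply: filterE.
have [e2E|e2E] := eqVneq e2 (~~ e); last first.
  by right; apply: filterS U => n U; rewrite /= (negbTE e2E).
case: qs => qk2 qs.
have [[g qg Hg]|N] := quasipoly_dvd e qk1; [left|right].
  exists (fun n => k n + bs_exp m n (~~ e) * g n + k2 n), s; split => //.
    by apply: quasipolyD => //; apply: quasipolyD => //; apply: quasipolyM => //;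
      exact: quasipoly_bs_exp.
  by apply: filterS Hg => n /= ->; rewrite e2E; exact: PinchHead.
by apply: filterS2 U N => n U N; rewrite /= (negbTE N) andbF.
Qed.

(** Each pinch lowers the number of [a]-letters. An unpinched word with an [a]-letter is nontrivial;
    without one it is a power of [b], trivial iff its exponent is 0. *)
Lemma sword_decided k s : quasipoly k -> quasipolys s ->
  decided (fun n =>
    weval (presented_group (bs_rel m n)) (sword (k n) (seval s n)) = 1%g).
Proof.
have [b] := ubnP (size s); elim: b s k => // b IH s k; rewrite ltnS => sb qk qs.
have [[k' [s' [qk' qs' ss' P]]]|U] := pinch_or_unpinched qk qs.
  have [H|H] := IH s' k' (leq_trans ss' sb) qk' qs'; [left|right];
    by apply: filterS2 P H => n /pinch_weval ->.
have Bn : \forall n \near F,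
    weval (presented_group (bs_rel m n)) (sword (k n) (seval s n)) = 1%g ->
    k n = 0 /\ seval s n = [::].
  by apply: filterS2 near_neq0 U => n n0 un; rewrite weval_presented1; exact: britton.
have [s0|s0] := eqVneq (size s) 0%N; last first.
  right; apply: filterS Bn => n Bn /Bn[_ /(congr1 size)].
  by rewrite size_map => /eqP; rewrite (negbTE s0).
have [k0|k0] := quasipoly_eq0_decided qk; [left|right].
  by apply: filterS k0 => n ->; rewrite (size0nil s0) weval_nil.
by apply: filterS2 k0 Bn => n k0 Bn /Bn[].
Qed.

Lemma gen_index2 (i : gen_index 2) : i = letter_a \/ i = letter_b.
Proof. by case: i => -[|[|//]] p; [left|right]; apply: val_inj. Qed.

Lemma word_sword (w : word 2) : exists k (s : seq (bool * int)), forall n,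
  weval (presented_group (bs_rel m n)) w =
  weval (presented_group (bs_rel m n)) (sword k s).
Proof.
elim: w => [|[i e] w [k [s ws]]]; first by exists 0, [::].
have [->|->] := gen_index2 i.
  exists 0, ((e, k) :: s) => n.
  by rewrite weval_sword_cons weval_cons ws /= mul1g.
exists ((if e then 1 else -1) + k), s => n.
rewrite weval_swordD weval_cons ws; congr (_ * _)%g.
by rewrite /weval big_cons big_nil mulg1; case: e.
Qed.

Lemma word_decided (w : word 2) :
  decided (fun n => weval (presented_group (bs_rel m n)) w = 1%g).
Proof.
have [k [s ws]] := word_sword w.
pose s' := [seq (p.1, fun=> p.2) | p <- s] : seq (bool * (int -> int)).
have qs' : quasipolys s'.
  rewrite /s'; elim: {ws s'} s => [//|[e k1] s IH].
  by split => //; exact: quasipoly_cst.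
have s'E n : seval s' n = s.
  by rewrite /seval -map_comp -[RHS]map_id; apply: eq_map => -[].
by have [H|H] := sword_decided (quasipoly_cst k) qs'; [left|right];
  apply: filterS H => n; rewrite ws s'E.
Qed.

End EventualTriviality.

(** * Convergence to the group of eventual relations *)

Section LimitGroup.
Variables (R : realType) (m : int) (F : set_system int).
Hypotheses (m0 : m != 0) (FF : Filter F).
Hypothesis F_large : forall N, \forall n \near F, (N < `|n|)%N.
Hypothesis F_congr : forall h, exists c, \forall n \near F, (n = c %[mod m ^+ h])%Z.

Definition eventual_rel (u v : word 2) : Prop :=
  \forall n \near F, pres_eq (bs_rel m n) u v.

(** Eventual relations already form a congruence, because filters are closed under finite
    intersections. *)
Lemma pres_eq_eventual_rel u v : pres_eq eventual_rel u v <-> eventual_rel u v.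
Proof.
split; last exact: PresRel.
elim=> {u v} [//|l|u|u v _ H|u v w _ H1 _ H2|u u' v v' _ H1 _ H2].
- by apply: filterE => n; exact: PresCancel.
- by apply: filterE => n; exact: PresRefl.
- by apply: filterS H => n; exact: PresSym.
- by apply: filterS2 H1 H2 => n; exact: PresTrans.
- by apply: filterS2 H1 H2 => n; exact: PresCat.
Qed.

Lemma near_weval1 (w : word 2) : \forall n \near F,
  weval (presented_group eventual_rel) w = 1%g <->
  weval (presented_group (bs_rel m n)) w = 1%g.
Proof.
have E : weval (presented_group eventual_rel) w = 1%g <->
    \forall n \near F, weval (presented_group (bs_rel m n)) w = 1%g.
  rewrite weval_presented1 pres_eq_eventual_rel; split;
    by apply: filterS => n; rewrite weval_presented1.
have [H|H] := word_decided m0 FF F_large F_congr w.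
  have /E T := H; by apply: filterS H.
(* [F] is not assumed proper, so eventual nontriviality alone does not exclude eventual
   triviality. *)
have [/E H'|NE] := pselect (weval (presented_group eventual_rel) w = 1%g).
  by apply: filterS2 H H' => n.
by apply: filterS H => n H'; split=> [/NE|/H'].
Qed.

(** Only finitely many words have length [N]. [P] is general because the induction absorbs the first
    letter into it. *)
Lemma near_word_size (P : int -> word 2 -> Prop) N :
  (forall w, \forall n \near F, P n w) ->
  \forall n \near F, forall w, size w = N -> P n w.
Proof.
elim: N P => [|N IH] P FP; first by apply: filterS (FP [::]) => n Pn w /size0nil ->.
have {}IH l : \forall n \near F, forall w, size w = N -> P n (l :: w).
  by apply: (IH (fun n w => P n (l :: w))) => w; exact: FP.
have IHi i : \forall n \near F, forall e w, size w = N -> P n ((i, e) :: w).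
  by apply: filterS2 (IH (i, true)) (IH (i, false)) => n Ht Hf [].
apply: filterS2 (IHi letter_a) (IHi letter_b) => n Ha Hb [//|[i e] w] [sw].
by case: (gen_index2 i) => ->; [exact: Ha|exact: Hb].
Qed.

Lemma BS_cvg_eventual : BS R m n @[n --> F] --> mclass R (presented_group eventual_rel).
Proof.
apply/cvg_ballP => e e0.
have [N Ne] : exists N : nat, expR (- N%:R) < e.
  exists (Num.bound `|ln e|); rewrite -[ltRHS]lnK ?posrE // ltr_expR ltrNl.
  by rewrite (le_lt_trans _ (archi_boundP (normr_ge0 _))) // -normrN ler_norm.
have small : \forall n \near F, forall w : word 2, (size w <= N)%N ->
    weval (presented_group eventual_rel) w = 1%g <->
    weval (presented_group (bs_rel m n)) w = 1%g.
  elim: N {Ne} => [|N IH].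
    apply: filterS (near_word_size 0 near_weval1) => n H w.
    by rewrite leqn0 => /eqP; exact: H.
  apply: filterS2 IH (near_word_size N.+1 near_weval1) => n H1 H2 w.
  by rewrite leq_eqVlt => /orP[/eqP|]; [exact: H2|exact: H1].
apply: filterS small => n small; rewrite ballEmdist /=.
rewrite -[mdist _ _]/(space_dist _ _) space_distE.
(* A nonzero distance is attained at a distinguishing word, which cannot be shorter than [N]. *)
have [->//|[w [_ dw ->]]] := marked_distP R
  (presented_group eventual_rel) (presented_group (bs_rel m n)).
apply: le_lt_trans Ne; rewrite ler_expR lerN2 ler_nat.
by rewrite leqNgt; apply/negP => wN; apply: dw; apply: small; exact: ltnW.
Qed.

End LimitGroup.

(** * Convergence in initial and product topologies *)

Lemma cvg_initial (S : choiceType) (T : topologicalType) (f : S -> T)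
    (F : set_system S) (s : S) : Filter F ->
  f x @[x --> F] --> f s -> F --> (s : initial_topology f).
Proof.
move=> FF Ffs A; rewrite nbhsE => -[_ [[B oB <-] Bfs] BA].
by apply: filterS BA _; apply: Ffs; exact: open_nbhs_nbhs.
Qed.

Lemma cvg_prod_topology (I : Type) (T : I -> topologicalType)
    (F : set_system (prod_topology T)) (t : prod_topology T) : Filter F ->
  (forall i, x i @[x --> F] --> t i) -> F --> t.
Proof. by move=> FF Ft; apply/cvg_sup => i; exact: cvg_initial. Qed.

(** * The filter of large integers approaching an [m]-adic integer *)

Section AdicFilter.
Variable m : int.
Hypothesis m0 : m != 0.

Definition coord (xi : Zadic m) (h : nat) : residues m h := \val xi h.

Lemma near_coord (xi : Zadic m) h : \forall y \near xi, coord y h = coord xi h.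
Proof.
have c1 : {for xi, continuous (\val : Zadic m -> _)} by exact: initial_continuous.
have c2 := @proj_continuous nat (fun h => discrete_topology (residues m h)) h (\val xi).
exact: (c1 _ (c2 _ (discrete_set1 _))).
Qed.

Lemma residue_residue h k z : (h <= k)%N ->
  residue m h (residue m k z)%:Z = residue m h z.
Proof.
move=> hk; apply/val_inj/eqP; rewrite -eqz_nat; apply/eqP; rewrite !residueE //.
have -> : m ^+ k = m ^+ (k - h) * m ^+ h by rewrite -exprD subnK.
by rewrite [in RHS](divz_eq z (m ^+ (k - h) * m ^+ h)) mulrA modzMDl.
Qed.

Lemma coordS (xi : Zadic m) h : residue m h (coord xi h.+1)%:Z = coord xi h.
Proof. by have /set_mem := valP xi; apply. Qed.

Lemma residue_coord (xi : Zadic m) h k : (h <= k)%N ->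
  residue m h (coord xi k)%:Z = coord xi h.
Proof.
elim: k => [|k IH]; first by rewrite leqn0 => /eqP ->; rewrite -coordS residue_residue.
rewrite leq_eqVlt => /predU1P[->|]; first by rewrite -coordS residue_residue.
by rewrite ltnS => hk; rewrite -(residue_residue _ hk) coordS IH.
Qed.

(** Every admissible sequence for [xi] tends to this filter, so a limit along it is common to all of
    them. *)
Definition adic_filter (xi : Zadic m) : set_system int :=
  [set A | exists h N, forall n, (N < `|n|)%N -> residue m h n = coord xi h -> A n].

Lemma adic_filter_large xi N : \forall n \near adic_filter xi, (N < `|n|)%N.
Proof. by exists 0%N, N. Qed.

Lemma adic_filter_congr xi h :
  exists c, \forall n \near adic_filter xi, (n = c %[mod m ^+ h])%Z.
Proof.
exists (coord xi h)%:Z, h, 0%N => n _ <-.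
by rewrite residueE // modz_mod.
Qed.

#[local] Instance adic_filter_filter xi : Filter (adic_filter xi).
Proof.
split=> [|A B [h [N HA]] [k [M HB]]|A B AB [h [N HA]]].
- by exists 0%N, 0%N.
- exists (maxn h k), (maxn N M) => n; rewrite gtn_max => /andP[Nn Mn] E.
  split; [apply: HA => //|apply: HB => //].
    by rewrite -(residue_residue n (leq_maxl h k)) E residue_coord ?leq_maxl.
  by rewrite -(residue_residue n (leq_maxr h k)) E residue_coord ?leq_maxr.
- by exists h, N => n Nn /(HA _ Nn)/AB.
Qed.

(** Membership of [A] involves [xi] only modulo one [m ^+ h]; this is the source of the
    continuity. *)
Lemma near_adic_filter xi A : adic_filter xi A -> \forall y \near xi, adic_filter y A.
Proof.
case=> h [N HA]; apply: filterS (near_coord xi h) => y yE.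
by exists h, N => n Nn nE; apply: HA; rewrite // -yE.
Qed.

Lemma admissible_cvg (xi : Zadic m) u : admissible xi u ->
  u i @[i --> \oo] --> adic_filter xi.
Proof.
move=> [_ /cvgnyPgt u_large u_cvg] A [h [N HA]].
have : \forall i \near \oo, coord (Zadic_of_int m (u i)) h = coord xi h.
  exact: u_cvg (near_coord xi h).
by apply: filterS2 (u_large N) => i; exact: HA.
Qed.

Lemma admissible_exists (xi : Zadic m) : exists u, admissible xi u.
Proof.
(* The shift is a multiple of [m ^+ i], which keeps the residue at level [i]; the factor [i.+1]
   makes [u i] exceed [i] even if [m] is a unit. *)
pose u i : int := (coord xi i)%:Z + ((i.+1 * `|m| ^ i)%N)%:Z.
have u_gt i : (i < `|u i|)%N.
  rewrite /u absz_nat (leq_trans _ (leq_addl _ _)) //.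
  by rewrite leq_pmulr // expn_gt0 absz_gt0 m0.
exists u; split.
- by move=> i; rewrite -absz_gt0 (leq_ltn_trans _ (u_gt i)).
- apply/cvgnyPgt => N; exists N => // i /= Ni.
  exact: leq_ltn_trans Ni (u_gt i).
- apply: cvg_initial; apply: cvg_prod_topology => h.
  apply/discrete_cvg; exists h => // i /= hi.
  suff : residue m h (u i) = coord xi h by [].
  rewrite -(residue_coord xi hi); apply/val_inj/eqP; rewrite -eqz_nat; apply/eqP.
  rewrite !residueE //; apply/eqP; rewrite eqz_mod_dvd /u addrAC subrr add0r.
  by rewrite dvdzE abszX dvdn_mull // dvdn_exp2l.
Qed.

(** The group of eventual relations is a limit common to all admissible sequences, so [xget] does
    not return its default; uniqueness of the limit along one such sequence identifies the two. *)
Lemma BSbar_cvg (R : realType) (xi : Zadic m) :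
  BS R m n @[n --> adic_filter xi] --> BSbar R xi.
Proof.
have L := @BS_cvg_eventual R _ _ m0 (adic_filter_filter xi)
  (adic_filter_large xi) (adic_filter_congr xi).
set l := mclass R _ in L.
have lP : is_BSbar xi l.
  by move=> u /admissible_cvg uF; exact: cvg_comp uF L.
have bP : is_BSbar xi (BSbar R xi).
  exact: (@xgetPex _ _ [set l | is_BSbar xi l] (ex_intro _ l lP)).
have [u au] := admissible_exists xi.
by rewrite (cvg_unique (@metric_hausdorff _ _) (bP u au) (lP u au)).
Qed.

End AdicFilter.

Theorem theorem2 (R : realType) (m : int) (hm : m != 0) :
  continuous (@BSbar R m).
Proof.
move=> xi; apply/(@cvg_ballP _ _ _ _ (nbhs_filter xi)) => e e0.
have FF := adic_filter_filter hm.
have e2 : 0 < e / 2 by rewrite divr_gt0.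
(* The [e / 2]-ball around [BSbar R xi] contains [BS R m n] along the filter at [xi], hence along
   the filter at every [y] near [xi]. *)
have /cvg_ballP/(_ _ e2)/near_adic_filter xiF := @BSbar_cvg _ hm R xi.
apply: filterS xiF => y yF.
(* An admissible sequence for [y] provides one [n] with [BS R m n] within [e / 2] of both limits. *)
have [u /admissible_cvg uy] := admissible_exists hm y.
have /cvg_ballP/(_ _ e2)/uy uBSy := @BSbar_cvg _ hm R y.
have uBSxi := uy _ yF.
have [i [iy ixi]] := filter_ex (filterI uBSy uBSxi).
exact: ball_splitl ixi iy.
Qed.
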